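(* Let $f:X\to Y$ be a continuous open map between zero-dimensional locally compact Hausdorff spaces, let $(A,I)=(CO(X),CK(X))$, $(B,J)=(CO(Y),CK(Y))$, and let $\varphi=\Theta^t(f):B\to A$ be given by $\varphi(G)=f^{-1}(G)$. Then the following are equivalent: $f$ is an injection; $\varphi(J)\supseteq I$; $\varphi(B)\supseteq I$.
   Context: A space is zero-dimensional if its clopen subsets form a base. $CO(X)$ is the Boolean algebra of clopen subsets of $X$ and $CK(X)$ is the set of compact clopen subsets of $X$. *)

(* Defs.v *)
From HB Require Import structures.
From mathcomp Require Import all_boot all_order.
From mathcomp Require Import all_classical topology.

Set Implicit Arguments.
Unset Strict Implicit.
Unset Printing Implicit Defensive.

Local Open Scope classical_set_scope.

(* The library notion [zero_dimensional] is different: it only requires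
   distinct points to be separated by a clopen set. *)
Definition clopen_based (T : topologicalType) : Prop := basis (@clopen T).

Definition open_map (X Y : topologicalType) (f : X -> Y) : Prop :=
  forall U : set X, open U -> open (f @` U).

(* The Boolean algebra of clopen sets is represented as a field of sets, with
   the operations of [set T]. *)
Definition CO (T : topologicalType) : set (set T) := [set G | clopen G].

Definition CK (T : topologicalType) : set (set T) :=
  [set K | compact K /\ clopen K].

Arguments CO T : clear implicits.
Arguments CK T : clear implicits.

(* Defined on all subsets of [Y]; for continuous [f] it restricts to a map
   from [CO Y] to [CO X], see [Theta_CO]. *)
Definition Theta (X Y : topologicalType) (f : X -> Y) : set Y -> set X :=
  fun G => f @^-1` G.

Lemma Theta_CO (X Y : topologicalType) (f : X -> Y) :
  continuous f -> set_fun (CO Y) (CO X) (Theta f).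
Proof. by move=> cf G clG; exact: (preimage_clopen clG cf). Qed.

(* Main.v *)
Require Import Defs.
From HB Require Import structures.
From mathcomp Require Import all_boot all_order.
From mathcomp Require Import all_classical topology.

Local Open Scope classical_set_scope.

(** An injective [f] satisfies [f @^-1` (f @` K) = K] for every [K], so a
    compact clopen [K] is the preimage of its image, and that image is again
    compact clopen: compact by continuity, open because [f] is open, and closed
    as a compact subset of a Hausdorff space.  Conversely, a preimage
    [f @^-1` G] cannot separate two points with the same value under [f],
    whereas the compact clopen sets separate any two distinct points of [X],
    because they form a base ([basis_CK]) of a Hausdorff space. *)

(** Local compactness bounds the size of small neighbourhoods: a clopen set
    contained in a compact neighbourhood is closed in a compact set, hence
    compact. *)
Lemma basis_CK (T : topologicalType) :
  clopen_based T -> locally_compact [set: T] -> basis (CK T).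
Proof.
move=> [_ zdT] lcT; split=> [K [_ [] //]|x U Ux].
have [C] := lcT x I; rewrite withinET => Cx [cptC _].
have [V [clV Vx] VCU] := zdT x _ (filterI Cx Ux).
exists V => [|y /VCU [] //]; split=> //; split=> //.
by apply: (subclosed_compact clV.2 cptC) => y /VCU [].
Qed.

Lemma image_CK (X Y : topologicalType) (f : X -> Y) :
  hausdorff_space Y -> continuous f -> open_map f ->
  set_fun (CK X) (CK Y) (fun K => f @` K).
Proof.
move=> hsY cf of_ K [cptK [oK _]].
have cptfK : compact (f @` K).
  by apply: continuous_compact cptK; exact: continuous_subspaceT.
by split=> //; split; [exact: of_|exact: compact_closed].
Qed.

Lemma injective_Theta_image (X Y : topologicalType) (f : X -> Y) (A : set X) :
  injective f -> Theta f (f @` A) = A.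
Proof.
move=> injf; apply/seteqP; split=> [x [y Ay /injf <-] //|].
exact: preimage_image.
Qed.

(** A base of a Hausdorff space separates points, while preimages under [f]
    do not separate points of one fibre.  Stated for arbitrary families, so that
    the target family can be [CO Y], the larger of the two. *)
Lemma basis_sub_Theta_injective (X Y : topologicalType) (f : X -> Y)
    (B : set (set X)) (S : set (set Y)) :
  hausdorff_space X -> basis B -> B `<=` Theta f @` S -> injective f.
Proof.
move=> hsX [_ baseB] BS x y fxy; apply: contrapT => /eqP xy.
have [U [oU /set_mem Ux /set_mem nUy]] := hausdorff_accessible hsX xy.
have [K [BK Kx] KU] := baseB x U (open_nbhs_nbhs (conj oU Ux)).
apply/nUy/KU; have [G _ GK] := BS K BK.
by move: Kx; rewrite /id -GK /Theta /preimage/= fxy.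
Qed.

Theorem theorem3p12 (X Y : topologicalType) (f : X -> Y)
  (zdX : clopen_based X) (lcX : locally_compact [set: X])
  (hsX : hausdorff_space X)
  (zdY : clopen_based Y) (lcY : locally_compact [set: Y])
  (hsY : hausdorff_space Y)
  (cf : continuous f) (of_ : open_map f) :
  [<-> injective f;
       CK X `<=` Theta f @` CK Y;
       CK X `<=` Theta f @` CO Y].
Proof.
tfae.
- move=> injf K CKK; exists (f @` K); first exact: image_CK.
  exact: injective_Theta_image.
- by move=> CKJ K /CKJ [G [_ clG] <-]; exists G.
- by apply: basis_sub_Theta_injective hsX _; exact: basis_CK.
Qed.
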